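(* Let $f:\mathbb{R}^N\to\mathbb{R}$ be continuously differentiable, let $C>0$ be such that $f(\theta)>-C$ for all $\theta\in\mathbb{R}^N$, let $\mathcal{L}:\mathbb{R}^N\to\mathbb{R}^N$ be a self-adjoint linear operator, and let $\eta\in[0,1]$. Let $\delta t>0$ be arbitrary, and let $(\theta_k)_{k\ge0}\subset\mathbb{R}^N$, $(r_k)_{k\ge 0}\subset\mathbb{R}$, $(\tilde r_{k})_{k\ge1}\subset\mathbb{R}$, with $r_0=\sqrt{f(\theta_0)+C}$, be generated by the relaxed SAV (RSAV) scheme: for every $k\ge0$, $$\frac{\theta_{k+1}-\theta_k}{\delta t}+\mathcal{L}\theta_{k+1}+\frac{\nabla f(\theta_k)}{\sqrt{f(\theta_k)+C}}\,\tilde r_{k+1}-\mathcal{L}\theta_k=0,$$ $$\frac{\tilde r_{k+1}-r_k}{\delta t}=\left(\frac{\nabla f(\theta_k)}{2\sqrt{f(\theta_k)+C}},\ \frac{\theta_{k+1}-\theta_k}{\delta t}\right),$$ $$r_{k+1}=\xi\,\tilde r_{k+1}+(1-\xi)\sqrt{f(\theta_{k+1})+C},$$ where, at each step, the relaxation parameter $\xi$ (which may depend on $k$) is chosen in $[0,1]$ so that $$r_{k+1}^2-\tilde r_{k+1}^2-(\tilde r_{k+1}-r_k)^2\le \eta\,\mathcal{G}(\theta_{k+1},\theta_k).$$ If $\mathcal{L}$ is non-negative, then for any $\delta t>0$ the modified energy $r^2$ is unconditionally diminishing, in the sense that for every $k\ge0$ $$r_{k+1}^2-r_k^2\le-(1-\eta)\,\mathcal{G}(\theta_{k+1},\theta_k)\le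 0 .$$
   Context: $(\cdot,\cdot)$ and $\|\cdot\|$ denote the Euclidean ($l^2$) inner product and norm on $\mathbb{R}^N$. ''Non-negative'' means $(\mathcal{L}x,x)\ge 0$ for all $x\in\mathbb{R}^N$. With $A=I+\delta t\,\mathcal{L}$, one sets $$\mathcal{G}(\theta_{k+1},\theta_k)=\frac{1}{\delta t}\big(\theta_{k+1}-\theta_k,\ A(\theta_{k+1}-\theta_k)\big).$$ *)

(* Defs.v *)
From HB Require Import structures.
From mathcomp Require Import all_boot all_order all_algebra.
From mathcomp Require Import all_classical all_reals all_analysis.

Set Implicit Arguments.
Unset Strict Implicit.
Unset Printing Implicit Defensive.

Import Order.TTheory GRing.Theory Num.Theory.
Import numFieldNormedType.Exports.

Local Open Scope ring_scope.

(* The library norm on 'rV[R]_N is the sup norm, so the Euclidean inner product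
   is introduced separately; differentiability and continuity on 'rV[R]_N do
   not depend on the choice of norm. *)
Definition dotv (R : realType) (N : nat) (x y : 'rV[R]_N) : R :=
  \sum_(i < N) x 0 i * y 0 i.

Definition grad (R : realType) (N : nat) (f : 'rV[R]_N -> R)
    (x : 'rV[R]_N) : 'rV[R]_N :=
  \row_(i < N) 'D_(delta_mx 0 i) f x.

Definition continuously_differentiable (R : realType) (N : nat)
    (f : 'rV[R]_N -> R) : Prop :=
  (forall x : 'rV[R]_N, differentiable f x) /\ continuous (grad f).

Definition self_adjoint (R : realType) (N : nat)
    (L : 'rV[R]_N -> 'rV[R]_N) : Prop :=
  forall x y : 'rV[R]_N, dotv (L x) y = dotv x (L y).

Definition nonnegative_op (R : realType) (N : nat)
    (L : 'rV[R]_N -> 'rV[R]_N) : Prop :=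
  forall x : 'rV[R]_N, 0 <= dotv (L x) x.

Definition opA (R : realType) (N : nat) (dt : R) (L : 'rV[R]_N -> 'rV[R]_N)
    (x : 'rV[R]_N) : 'rV[R]_N :=
  x + dt *: L x.

Definition calG (R : realType) (N : nat) (dt : R) (L : 'rV[R]_N -> 'rV[R]_N)
    (u v : 'rV[R]_N) : R :=
  dt^-1 * dotv (u - v) (opA dt L (u - v)).

(* [theta], [r] and [rt] (for r tilde) are sequences indexed by the step; the
   value [rt 0] is never used.  [xi k] is the relaxation parameter of the step
   from [k] to [k.+1]. *)
Record rsav_scheme (R : realType) (N : nat) (f : 'rV[R]_N -> R) (C : R)
    (L : 'rV[R]_N -> 'rV[R]_N) (eta dt : R)
    (theta : nat -> 'rV[R]_N) (r rt xi : nat -> R) : Prop := RsavScheme {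
  rsav_init : r 0%N = Num.sqrt (f (theta 0%N) + C);
  rsav_theta : forall k : nat,
    dt^-1 *: (theta k.+1 - theta k) + L (theta k.+1)
      + rt k.+1 *: ((Num.sqrt (f (theta k) + C))^-1 *: grad f (theta k))
      - L (theta k) = 0;
  rsav_rt : forall k : nat,
    (rt k.+1 - r k) / dt =
      dotv ((2 * Num.sqrt (f (theta k) + C))^-1 *: grad f (theta k))
           (dt^-1 *: (theta k.+1 - theta k));
  rsav_r : forall k : nat,
    r k.+1 = xi k * rt k.+1 + (1 - xi k) * Num.sqrt (f (theta k.+1) + C);
  rsav_xi01 : forall k : nat, 0 <= xi k <= 1;
  rsav_xi : forall k : nat,
    r k.+1 ^+ 2 - rt k.+1 ^+ 2 - (rt k.+1 - r k) ^+ 2 <=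
      eta * calG dt L (theta k.+1) (theta k)
}.

(* Main.v *)
(* Pair the theta-equation with the increment d = theta_{k+1} - theta_k and
   insert the equation for r~: this gives 2 r~_{k+1} (r~_{k+1} - r_k) = - G.
   By 2 a (a - b) = a^2 - b^2 + (a - b)^2, the unrelaxed step thus dissipates
   r~_{k+1}^2 - r_k^2 = - G - (r~_{k+1} - r_k)^2, and the relaxation gives back
   at most (r~_{k+1} - r_k)^2 + eta G. *)
Require Import Defs.
From HB Require Import structures.
From mathcomp Require Import all_boot all_order all_algebra.
From mathcomp Require Import all_classical all_reals all_analysis.
From mathcomp Require Import ring lra.

Set Implicit Arguments.
Unset Strict Implicit.
Unset Printing Implicit Defensive.

Import Order.TTheory GRing.Theory Num.Theory.
Import numFieldNormedType.Exports.

Local Open Scope ring_scope.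

Lemma dotvC (R : realType) (N : nat) (x y : 'rV[R]_N) : dotv x y = dotv y x.
Proof. by apply: eq_bigr => i _; rewrite mulrC. Qed.

Lemma dotvDl (R : realType) (N : nat) (x y z : 'rV[R]_N) :
  dotv (x + y) z = dotv x z + dotv y z.
Proof. by rewrite -big_split; apply: eq_bigr => i _; rewrite mxE mulrDl. Qed.

Lemma dotvZl (R : realType) (N : nat) (a : R) (x y : 'rV[R]_N) :
  dotv (a *: x) y = a * dotv x y.
Proof. by rewrite /dotv mulr_sumr; apply: eq_bigr => i _; rewrite mxE mulrA. Qed.

Lemma dotvZr (R : realType) (N : nat) (a : R) (x y : 'rV[R]_N) :
  dotv x (a *: y) = a * dotv x y.
Proof. by rewrite dotvC dotvZl dotvC. Qed.

Lemma dotvv_ge0 (R : realType) (N : nat) (x : 'rV[R]_N) : 0 <= dotv x x.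
Proof. by apply: sumr_ge0 => i _; rewrite -expr2 sqr_ge0. Qed.

(** The factor [dt] inside [opA] cancels the prefactor [dt^-1]. The resulting split serves both the
    sign of [calG] and the match with the paired scheme. *)
Lemma calGE (R : realType) (N : nat) (dt : R) (L : 'rV[R]_N -> 'rV[R]_N)
    (u v : 'rV[R]_N) : dt != 0 ->
  calG dt L u v = dt^-1 * dotv (u - v) (u - v) + dotv (L (u - v)) (u - v).
Proof.
by move=> dt0; rewrite /calG /opA dotvC dotvDl dotvZl mulrDr mulKf.
Qed.

Lemma calG_ge0 (R : realType) (N : nat) (dt : R) (L : 'rV[R]_N -> 'rV[R]_N)
    (u v : 'rV[R]_N) : 0 < dt -> nonnegative_op L -> 0 <= calG dt L u v.
Proof.
move=> dt_gt0 L_ge0; rewrite calGE ?gt_eqF// addr_ge0//.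
by rewrite mulr_ge0 ?dotvv_ge0 ?invr_ge0 ?ltW.
Qed.

Lemma rsav_dissipation (R : realType) (N : nat) (f : 'rV[R]_N -> R) (C : R)
    (L : {linear 'rV[R]_N -> 'rV[R]_N}) (eta dt : R)
    (theta : nat -> 'rV[R]_N) (r rt xi : nat -> R) (k : nat) :
  dt != 0 -> rsav_scheme f C L eta dt theta r rt xi ->
  2 * rt k.+1 * (rt k.+1 - r k) = - calG dt L (theta k.+1) (theta k).
Proof.
move=> dt0 scheme.
have := rsav_rt scheme k; have := rsav_theta scheme k.
(* By linearity the implicit and explicit [L] terms merge into [L] of the increment. *)
rewrite addrAC -[_ + L _ - L _]addrA -linearB calGE//.
move: (theta k.+1 - theta k) (Num.sqrt _) (grad f _) => d s g.
move=> /(congr1 (fun v => dotv v d)); rewrite /= !dotvDl !dotvZl.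
have -> : dotv 0 d = 0 by rewrite -(scale0r d) dotvZl mul0r.
(* Cancelling [dt^-1] turns the equation for [rt] into [rt k.+1 - r k = (2 * s)^-1 * dotv g d]. *)
move=> theta_eq; rewrite dotvZr mulrCA [LHS]mulrC => /(mulfI (invr_neq0 dt0)) ->.
(* With all terms on one side, the remaining 0 is replaced by the paired equation. *)
rewrite invfM; apply/eqP; rewrite -addr_eq0 addrC -theta_eq.
(* With the inverses made opaque, [field] only has the constant 2 to invert. *)
by move: (s^-1) (dt^-1) => s' dt'; apply/eqP; field.
Qed.

Theorem theorem2 (R : realType) (N : nat) (f : 'rV[R]_N -> R) (C : R)
    (L : {linear 'rV[R]_N -> 'rV[R]_N}) (eta dt : R)
    (theta : nat -> 'rV[R]_N) (r rt xi : nat -> R)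
    (f_C1 : continuously_differentiable f)
    (C_gt0 : 0 < C)
    (f_gtNC : forall x : 'rV[R]_N, - C < f x)
    (L_sa : self_adjoint L)
    (eta01 : 0 <= eta <= 1)
    (dt_gt0 : 0 < dt)
    (scheme : rsav_scheme f C L eta dt theta r rt xi)
    (L_ge0 : nonnegative_op L) :
  forall k : nat,
    r k.+1 ^+ 2 - r k ^+ 2 <= - (1 - eta) * calG dt L (theta k.+1) (theta k)
    /\ - (1 - eta) * calG dt L (theta k.+1) (theta k) <= 0.
Proof.
move=> k; have G_ge0 := calG_ge0 (theta k.+1) (theta k) dt_gt0 L_ge0.
have dissip := rsav_dissipation k (lt0r_neq0 dt_gt0) scheme.
have relax := rsav_xi scheme k.
have /andP[_ eta_le1] := eta01.
(* Once the squares are expanded, [relax] plus [dissip] is the claim, linear in the monomials. *)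
split; first by lra.
by rewrite mulNr oppr_le0 mulr_ge0// subr_ge0.
Qed.
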